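(* Let $k\in\mathbb{Z}$, $\gamma=2^{k}$, and let $I$ be a $4\gamma$-underallocated instance. Let $J$ be the instance obtained from $I$ by replacing every window $W[i]$ by $\mathrm{align}(W[i])$. Then $J$ is $\gamma$-underallocated.
   Context: Single processor. An instance $I=(n,T,W)$ consists of $n$ tasks with windows $W[1..n]$ (closed real intervals of positive length). For $\gamma>0$, a $\gamma$-solution assigns to each task an interval of length $\gamma$ contained in its window, such that no two assigned intervals have intersecting interiors; $I$ is $\gamma$-underallocated iff it has a $\gamma$-solution. An interval is aligned iff it equals $[a2^{j},(a+1)2^{j}]$ for some integers $j,a$; $\mathrm{align}(Z)$ denotes some largest aligned interval contained in $Z$. *)

(* Defs.v *)
From HB Require Import structures.
From mathcomp Require Import all_boot all_order all_algebra.
From mathcomp Require Import all_classical all_reals all_analysis.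
From mathcomp Require Import lra.
Import Order.TTheory GRing.Theory Num.Theory.
Import numFieldNormedType.Exports.

Set Implicit Arguments.
Unset Strict Implicit.
Unset Printing Implicit Defensive.

Local Open Scope classical_set_scope.
Local Open Scope ring_scope.

(* Closed real intervals of positive length. *)
Record citv (R : realType) := Citv {
  lo : R;
  hi : R;
  lo_lt_hi : lo < hi }.

Definition len (R : realType) (Z : citv R) : R := hi Z - lo Z.

Definition set_of_citv (R : realType) (Z : citv R) : set R :=
  `[lo Z, hi Z]%classic.

Coercion set_of_citv : citv >-> set.

(* An instance with n tasks: the tasks are the indices, mapped to windows. *)
Definition instance (R : realType) (n : nat) := 'I_n -> citv R.

Definition solution (R : realType) (n : nat) (g : R) (W : instance R n)
    (S : 'I_n -> citv R) : Prop :=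
  [/\ forall i, len (S i) = g,
      forall i, (S i : set R) `<=` (W i : set R) &
      forall i j, i != j ->
        interior (S i : set R) `&` interior (S j : set R) = set0].

Definition underallocated (R : realType) (n : nat) (g : R)
    (W : instance R n) : Prop :=
  exists S : 'I_n -> citv R, solution g W S.

(* Both exponent and multiplier are integers, possibly negative. *)
Definition aligned (R : realType) (Z : citv R) : Prop :=
  exists j a : int,
    (Z : set R) = `[a%:~R * 2 ^ j, (a + 1)%:~R * 2 ^ j]%classic.

(* Largest aligned subintervals need not be unique, so align is a relation:
   [is_align Z A] means that A is an admissible value of align(Z). *)
Definition is_align (R : realType) (Z A : citv R) : Prop :=
  [/\ aligned A,
      (A : set R) `<=` (Z : set R) &
      forall B : citv R, aligned B -> (B : set R) `<=` (Z : set R) ->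
        len B <= len A].

Lemma subset_citv (R : realType) (A Z : citv R) :
  ((A : set R) `<=` (Z : set R)) <-> (lo Z <= lo A /\ hi A <= hi Z).
Proof.
have /ltW lhA := lo_lt_hi A.
split=> [AZ|[ll hh] x]; rewrite /set_of_citv /=.
- have := AZ (lo A); rewrite /set_of_citv /= !in_itv /= lexx lhA => /(_ isT) /andP[-> _].
  have := AZ (hi A); rewrite /set_of_citv /= !in_itv /= lexx lhA => /(_ isT) /andP[_ ->].
  by [].
- by rewrite !in_itv /= => /andP[lx xh]; rewrite (le_trans ll) // (le_trans xh).
Qed.

Lemma citv_inj (R : realType) (A : citv R) (x y : R) :
  x < y -> (A : set R) = `[x, y]%classic -> lo A = x /\ hi A = y.
Proof.
move=> xy AE.
have := (subset_citv A (Citv xy)).1; rewrite {1}AE => /(_ (fun _ h => h)) /= [a b].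
have := (subset_citv (Citv xy) A).1; rewrite {1}AE => /(_ (fun _ h => h)) /= [c d].
by split; apply/eqP; rewrite eq_le ?a ?b ?c ?d.
Qed.

Lemma is_align_exists (R : realType) (Z : citv R) : exists A, is_align Z A.
Proof.
have pow_gt0 (j : int) : 0 < 2 ^ j :> R by rewrite exprz_gt0.
have itv_lt (a j : int) : a%:~R * 2 ^ j < (a + 1)%:~R * 2 ^ j :> R.
  by rewrite ltr_pM2r // ltr_int ltrDl.
have big (x : R) : exists m : nat, x < 2 ^ m%:Z.
  exists (Num.bound x); rewrite -exprnP; exact: upper_nthrootP.
have d_gt0 : 0 < len Z by rewrite subr_gt0 lo_lt_hi.
have [M dM] := big (len Z).
pose P (m : nat) : Prop := exists a : int,
  lo Z <= a%:~R * 2 ^ (M%:Z - m%:Z) /\ (a + 1)%:~R * 2 ^ (M%:Z - m%:Z) <= hi Z.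
have exP : exists m, `[< P m >].
  have [N dN] := big (2 / len Z); exists (M + N)%N; apply/asboolP; rewrite /P.
  have -> : M%:Z - (M + N)%N%:Z = - N%:Z by rewrite PoszD opprD addrA subrr add0r.
  set e : R := 2 ^ (- N%:Z).
  have e_gt0 : 0 < e := pow_gt0 _.
  have e2 : 2 * e <= len Z.
    rewrite /e -invr_expz ler_pdivrMr // mulrC.
    by move: dN; rewrite ltr_pdivrMr // => /ltW.
  exists (Num.ceil (lo Z / e)); split.
    by rewrite -ler_pdivrMr // ceil_ge.
  have := ceilB1_lt (lo Z / e).
  rewrite intrB ltrBlDr -(ltr_pM2r e_gt0) mulrDl.
  rewrite divfK ?gt_eqF // mul1r intrD mulrDl mul1r => h.
  by move: e2; rewrite /len; lra.
case: (ex_minnP exP) => m /asboolP[a [al ah]] mmin.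
exists (Citv (itv_lt a (M%:Z - m%:Z))); split.
- by exists (M%:Z - m%:Z), a.
- exact/subset_citv.
move=> B [j [b BE]] /subset_citv [].
have [lB hB] := citv_inj (itv_lt b j) BE.
rewrite /len lB hB /= => l1 h1.
rewrite !intrD !mulrDl !mul1r !(addrC (_ * _)) !addrK.
rewrite leNgt; apply/negP => lt2.
have jM : j < M%:Z.
  rewrite -(@ltr_eXz2l R 2) ?ltr1n //.
  apply: le_lt_trans dM.
  have := lerB h1 l1.
  by rewrite intrD mulrDl mul1r addrAC subrr add0r.
have Mj : M%:Z - j = `|M%:Z - j|%N by rewrite gez0_abs // subr_ge0 ltW.
have := mmin `|M%:Z - j|%N; rewrite leqNgt => /(_ _)/negP; apply.
  by apply/asboolP; exists b; rewrite -Mj opprB addrC subrK.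
move: lt2; rewrite ltr_eXz2l ?ltr1n // => lt2.
by rewrite -ltz_nat -Mj ltrBlDr -ltrBlDl.
Qed.

(* Main.v *)
(** Let [A] be aligned with [|A| = 2 ^ j]. A window [Z] with
    [align Z = A] contains no aligned interval of length [2 ^ (j + 1)], hence
    lies between the two neighbours of the endpoint of [A] that is a multiple
    of [2 ^ (j + 1)], in an interval [H] of length [4 |A|]. A window whose
    aligned version is strictly inside [A] overhangs [A] by at most [|A|] on
    each side, so it lies in the same [H]. Packing the intervals of length
    [4 g] of the given solution into [H] shows that at most [|A| / g] tasks
    have their aligned window inside [A]. Aligned windows are laminar, so this
    count is enough for the greedy assignment of slots [[z g, (z + 1) g]],
    smallest windows first, never to get stuck. *)
Require Import Defs.
From mathcomp Require Import all_boot all_order all_algebra.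
From mathcomp Require Import all_classical all_reals all_analysis.
From mathcomp Require Import zify ring lra.
Import Order.TTheory GRing.Theory Num.Theory.
Import numFieldNormedType.Exports.
Local Open Scope ring_scope.

(** * Distinct representatives for laminar families *)

(** A laminar form of Hall's theorem: it is enough to count the windows that lie inside one
    window. *)
Lemma laminar_system_of_representatives (T : finType) (U : eqType)
    (w : T -> seq U) :
  (forall i, uniq (w i)) ->
  (forall i i' z, z \in w i -> z \in w i' -> (size (w i') <= size (w i))%N ->
    {subset w i' <= w i}) ->
  (forall i (A : {set T}), (forall i', i' \in A -> {subset w i' <= w i}) ->
    (#|A| <= size (w i))%N) ->
  exists2 f : T -> U, injective f & forall i, f i \in w i.
Proof.
move=> w_uniq w_laminar w_count.
(* [None] is the default value outside [A], as [U] may be empty. *)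
have partial N (A : {set T}) : #|A| = N -> exists2 f : T -> option U,
    forall i, i \in A -> exists2 z, f i = Some z & z \in w i &
    {in A &, injective f}.
  (* The task with the largest window is served last: every slot of its window
     already in use belongs, by laminarity, to a task counted by [w_count]. *)
  elim: N A => [|N IHN] A cardA.
    have -> : A = finset.set0 by apply/eqP; rewrite -cards_eq0 cardA.
    by exists (fun=> None) => [i|i i']; rewrite inE.
  have /card_gt0P[i0 i0A] : (0 < #|A|)%N by rewrite cardA.
  have [i iA imax] := @arg_maxnP _ i0 (mem A) (fun i => size (w i)) i0A.
  have cardD : #|A :\ i| = N.
    by apply/eqP; rewrite -eqSS -cardA (cardsD1 i A) (iA : i \in A).
  have [f fw finj] := IHN _ cardD.
  pose B := [set i' in A :\ i | has (fun z => f i' == Some z) (w i)].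
  have BP i' : i' \in B -> exists2 z, f i' = Some z & z \in w i.
    by rewrite inE => /andP[_ /hasP[z zi /eqP fz]]; exists z.
  have BsubA i' : i' \in B -> i' \in A :\ i by rewrite inE => /andP[].
  have Bcount : (#|B| < size (w i))%N.
    have iB : i \notin B by rewrite !inE eqxx.
    (* Counting [i] together with [B] makes the bound strict, so a slot of [w i] stays free. *)
    suff : (#|i |: B| <= size (w i))%N by rewrite cardsU1 iB.
    apply: w_count => i'; rewrite in_setU1 => /predU1P[-> //|i'B].
    have [z fz zi] := BP _ i'B.
    have i'A := BsubA _ i'B.
    have [z'] := fw _ i'A; rewrite fz => -[<-] zi'.
    apply: w_laminar zi zi' _; apply: imax.
    by move: i'A; rewrite in_setD1 => /andP[].
  have [z zi zfree] : exists2 z, z \in w i & forall i', i' \in A :\ i ->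
      f i' != Some z.
    pose taken := [seq f i' | i' <- enum B].
    have /allPn[z zi zN] : ~~ all (fun z => Some z \in taken) (w i).
      apply/negP => /allP taken_all.
      have : (size (map Some (w i)) <= size taken)%N.
        apply: uniq_leq_size; first by rewrite map_inj_uniq // => ? ? [].
        by move=> _ /mapP[z zi ->]; apply: taken_all.
      by rewrite !size_map -cardE leqNgt Bcount.
    exists z => // i' i'A; apply: contra zN => /eqP fz.
    apply/mapP; exists i'; last by rewrite fz.
    by rewrite mem_enum inE i'A; apply/hasP; exists z => //; apply/eqP.
  exists (fun i' => if i' == i then Some z else f i') => [i' i'A|i1 i2 i1A i2A].
    case: eqVneq => [->|i'i]; first by exists z.
    by apply: fw; rewrite in_setD1 i'i.
  have := zfree i1; have := zfree i2; have := finj i1 i2.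
  rewrite !in_setD1 i1A i2A !andbT.
  case: eqVneq => [->|_]; case: eqVneq => [->|_] //= fi z2 z1.
  - by move=> h; have := z2 isT; rewrite -h eqxx.
  - by move=> h; have := z1 isT; rewrite h eqxx.
  - exact: fi.
have [f fw finj] := partial _ [set: T] erefl.
have /choice[g gP] i : exists z, f i = Some z /\ z \in w i.
  by have [z] := fw i (finset.in_setT _); exists z.
exists g => [i i' gii'|i]; last by case: (gP i).
by apply: finj; rewrite ?finset.in_setT // (gP i).1 (gP i').1 gii'.
Qed.

(** * Packing disjoint intervals *)

(** Induction removing the rightmost interval: the others end at or before its start [s i], which
    becomes the new right bound. *)
Lemma packing_bound (R : realDomainType) (T : finType) (s : T -> R) (g : R)
    (A : {set T}) (x y : R) :
  x <= y ->
  (forall i, i \in A -> x <= s i /\ s i + g <= y) ->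
  {in A &, forall i j, i != j -> s i + g <= s j \/ s j + g <= s i} ->
  0 < g -> #|A|%:R * g <= y - x.
Proof.
move=> xy As Adisj g_gt0; have [N cardA] : exists N, #|A| = N by exists #|A|.
elim: N A y cardA xy As Adisj => [|N IHN] A y cardA xy As Adisj.
  by rewrite cardA mul0r subr_ge0.
have /card_gt0P[i0 i0A] : (0 < #|A|)%N by rewrite cardA.
have [i iA imax] := @Order.TotalTheory.arg_maxP _ _ _ i0 (mem A) s i0A.
have {}iA : i \in A by [].
have cardD : #|A :\ i| = N.
  by apply/eqP; rewrite -eqSS -cardA (cardsD1 i A) iA.
have [xi iy] := As _ iA.
have := IHN (A :\ i) (s i) cardD xi; rewrite cardA cardD -natr1 => IH.
suff : N%:R * g <= s i - x by nra.
apply: IH => [i'|i1 i2]; rewrite !in_setD1.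
  move=> /andP[i'i i'A]; have [xi' _] := As _ i'A; split=> //.
  have le_i : s i' <= s i := imax i' i'A.
  by case: (Adisj _ _ i'A iA i'i) => //; lra.
by move=> /andP[_ i1A] /andP[_ i2A]; apply: Adisj.
Qed.

Lemma interior_disjoint (R : realType) (A B : citv R) :
  (interior (A : set R) `&` interior (B : set R) = set0)%classic <->
  hi A <= lo B \/ hi B <= lo A.
Proof.
have hA := lo_lt_hi A; have hB := lo_lt_hi B.
rewrite /set_of_citv !interior_itv; split=> [AB0|AB]; last first.
  rewrite -subset0 => x [] /=; rewrite !in_itv /= => /andP[Ax xA] /andP[Bx xB].
  by case: AB; lra.
case: (leP (hi A) (lo B)) => [|BA]; first by left.
case: (leP (hi B) (lo A)) => [|AB]; first by right.
(* The overlap is [[l, h]], and its midpoint is interior to both intervals. *)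
exfalso; pose l := Num.max (lo A) (lo B); pose h := Num.min (hi A) (hi B).
have lh : l < h by rewrite lt_min !gt_max hA hB AB BA.
have [lA lB] : lo A <= l /\ lo B <= l by rewrite !le_max !lexx orbT.
have [Ah Bh] : h <= hi A /\ h <= hi B by rewrite !ge_min !lexx orbT.
suff : set0 ((l + h) / 2) by [].
by rewrite -AB0; split; rewrite /= in_itv /=; apply/andP; split; lra.
Qed.

(** * Dyadic intervals and the overhang of a window *)

Lemma dyadic_lt (R : realType) (j a : int) :
  a%:~R * 2 ^ j < (a + 1)%:~R * 2 ^ j :> R.
Proof. by rewrite ltr_pM2r ?exprz_gt0 // ltr_int ltrDl. Qed.

Definition dyadic_citv {R : realType} (j a : int) : citv R :=
  Citv (dyadic_lt R j a).

Lemma len_dyadic (R : realType) (j a : int) :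
  len (dyadic_citv j a : citv R) = 2 ^ j.
Proof. by rewrite /len /= intrD; ring. Qed.

Lemma alignedP (R : realType) (A : citv R) : aligned A ->
  exists j a : int, [/\ lo A = a%:~R * 2 ^ j, hi A = (a + 1)%:~R * 2 ^ j
                      & len A = 2 ^ j].
Proof.
move=> [j [a AE]]; exists j, a.
have [lA hA] := citv_inj (lo_lt_hi (dyadic_citv j a)) AE.
by split=> //; rewrite -(len_dyadic R j a) /len lA hA.
Qed.

Lemma aligned_dyadic (R : realType) (j a : int) :
  aligned (dyadic_citv j a : citv R).
Proof. by exists j, a. Qed.

(** The first multiple of [2 ^ k] from [lo Z] on is less than [2 ^ k] away, so the grid cell
    starting there fits in [Z]. *)
Lemma len_align_ge (R : realType) (Z A : citv R) (k : int) :
  is_align Z A -> 2 * 2 ^ k <= len Z -> 2 ^ k <= len A.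
Proof.
move=> [_ _ Amax] Zk; have e_gt0 : 0 < 2 ^ k :> R by rewrite exprz_gt0.
pose b := Num.ceil (lo Z / 2 ^ k).
rewrite -(len_dyadic R k b); apply: Amax; first exact: aligned_dyadic.
apply/subset_citv; rewrite /= -ler_pdivrMr // ceil_ge; split=> //.
have := ceilB1_lt (lo Z / 2 ^ k).
rewrite -/b intrB ltrBlDr -(ltr_pM2r e_gt0) mulrDl divfK ?gt_eqF // mul1r intrD.
by move: Zk; rewrite /len; lra.
Qed.

(** The two bounds are the ends of an aligned interval of level [j + 1], twice as long as [A]. *)
Lemma align_no_double (R : realType) (Z A : citv R) (j b : int) :
  is_align Z A -> len A = 2 ^ j ->
  lo Z <= (2 * b)%:~R * 2 ^ j -> (2 * b + 2)%:~R * 2 ^ j <= hi Z -> False.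
Proof.
move=> [_ _ Amax] lenA lZ hZ; have e_gt0 : 0 < 2 ^ j :> R by rewrite exprz_gt0.
have ej : 2 ^ (j + 1) = 2 * 2 ^ j :> R by rewrite expfzDr // expr1z mulrC.
have := Amax (dyadic_citv (j + 1) b) (aligned_dyadic _ _ _).
rewrite len_dyadic lenA ej => h.
suff : 2 * 2 ^ j <= 2 ^ j :> R by lra.
apply: h; apply/subset_citv; rewrite /= ej; move: lZ hZ.
rewrite !intrD !intrM; lra.
Qed.

Lemma int_parity (a : int) : exists c, a = 2 * c \/ a = 2 * c + 1.
Proof. by exists (a %/ 2)%Z; lia. Qed.

(** The parity of [a] tells which half of its dyadic parent [A] is. Excluding the parent from [Z]
    bounds the overhang on the sibling's side; excluding the parent's neighbour bounds the other
    side. *)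
Lemma align_margins (R : realType) (Z A : citv R) (j a : int) :
  is_align Z A -> lo A = a%:~R * 2 ^ j -> hi A = (a + 1)%:~R * 2 ^ j ->
  (forall c, a = 2 * c ->
     lo A - 2 * 2 ^ j <= lo Z /\ hi Z <= hi A + 2 ^ j) /\
  (forall c, a = 2 * c + 1 ->
     lo A - 2 ^ j <= lo Z /\ hi Z <= hi A + 2 * 2 ^ j).
Proof.
move=> alA lA hA; have e_gt0 : 0 < 2 ^ j :> R by rewrite exprz_gt0.
have lenA : len A = 2 ^ j by rewrite /len lA hA intrD; ring.
have [_ /subset_citv[lZ hZ] _] := alA.
split=> c ac; move: lA hA; rewrite ac !intrD intrM => lA hA.
  have := align_no_double _ _ _ _ (c - 1) alA lenA.
  have := align_no_double _ _ _ _ c alA lenA.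
  rewrite !intrD !intrM => h1 h2.
  by split; rewrite leNgt; apply/negP => lt; [apply: h2|apply: h1]; lra.
have := align_no_double _ _ _ _ (c + 1) alA lenA.
have := align_no_double _ _ _ _ c alA lenA.
rewrite !intrD !intrM => h1 h2.
by split; rewrite leNgt; apply/negP => lt; [apply: h1|apply: h2]; lra.
Qed.

Lemma align_hull (R : realType) (A : citv R) : aligned A ->
  exists x y, [/\ y - x = 4 * len A, x <= y &
    forall Z B : citv R, is_align Z B -> lo A <= lo B -> hi B <= hi A ->
      x <= lo Z /\ hi Z <= y].
Proof.
move=> /alignedP[j [a [lA hA lenA]]].
have [c ac] := int_parity a.
have e_gt0 : 0 < 2 ^ j :> R by rewrite exprz_gt0.
(* [x, y] is the union of the two aligned intervals of length [2 ^ (j + 1)]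
   around the endpoint of [A] that is a multiple of [2 ^ (j + 1)]. *)
exists ((2 * c - 2 * (a == 2 * c)%:R)%:~R * 2 ^ j).
exists ((2 * c - 2 * (a == 2 * c)%:R + 4)%:~R * 2 ^ j).
set b := (_ - _ : int).
split; first by rewrite lenA intrD; ring.
  by rewrite ler_pM2r // ler_int lerDl.
move=> Z B alB AB BA.
have [alignB _ _] := alB.
have [j' [a' [lB hB lenB]]] := alignedP _ _ alignB.
have [even' odd'] := align_margins _ _ _ _ _ alB lB hB.
have e'_gt0 : 0 < 2 ^ j' :> R by rewrite exprz_gt0.
(* The centre of [[x, y]] is the left end of [A] for even [a], its right end for odd [a]. *)
have bE : (a = 2 * c /\ b = 2 * c - 2) \/ (a = 2 * c + 1 /\ b = 2 * c).
  by rewrite /b; case: ac => ->; [left; rewrite eqxx|right; case: eqP]; lia.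
have jj' : j' <= j.
  by rewrite -(@ler_eXz2l R 2) ?ltr1n // -lenA -lenB /len lerB.
(* At equal level [B] is [A], and its margins are exactly those of [[x, y]]. *)
have [jE|jN] := eqVneq j' j.
  subst j'; have aE : a' = a.
    apply: (@intr_inj R); apply: (mulIf (lt0r_neq0 e_gt0)).
    by rewrite -lB -lA; move: lenA lenB; rewrite /len; lra.
  subst a'; move: lB hB; case: bE => -[aE ->].
    by have [] := even' _ aE; rewrite aE !intrD !intrM; lra.
  by have [] := odd' _ aE; rewrite aE !intrD !intrM; lra.
(* At a lower level the margins are at most [2 * 2 ^ j'], hence at most [2 ^ j], the smaller
   overhang of [[x, y]] over [A]. *)
have ee' : 2 * 2 ^ j' <= 2 ^ j :> R.
  have -> : 2 * 2 ^ j' = 2 ^ (j' + 1) :> R by rewrite expfzDr // expr1z mulrC.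
  by rewrite ler_eXz2l ?ltr1n //; lia.
have [Zl Zh] : lo B - 2 * 2 ^ j' <= lo Z /\ hi Z <= hi B + 2 * 2 ^ j'.
  by have [c' [/even'|/odd']] := int_parity a'; lra.
move: lA hA; case: bE => -[-> ->]; rewrite !intrD !intrM; lra.
Qed.

(** * Unit slots of a dyadic interval *)

(* The integers [z] with [[z, z + 1]] inside [[a * 2 ^ m, (a + 1) * 2 ^ m]]. *)
Definition slots (a : int) (m : nat) : seq int :=
  [seq a * 2 ^+ m + t%:Z | t <- iota 0 (2 ^ m)].

Lemma size_slots a m : size (slots a m) = (2 ^ m)%N.
Proof. by rewrite size_map size_iota. Qed.

Lemma uniq_slots a m : uniq (slots a m).
Proof.
by rewrite map_inj_uniq ?iota_uniq // => t t' /addrI [].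
Qed.

Lemma mem_slots a m z :
  (z \in slots a m) = (a * 2 ^+ m <= z < (a + 1) * 2 ^+ m).
Proof.
have -> : (a + 1) * 2 ^+ m = a * 2 ^+ m + (2 ^ m)%N%:Z.
  by rewrite mulrDl mul1r -natz natrX.
apply/mapP/idP => [[t]|/andP[az za]]; first by rewrite mem_iota => ? ->; lia.
by exists `|(z - a * 2 ^+ m)%R|%N; [rewrite mem_iota|]; lia.
Qed.

Lemma slots_subset a m a' m' : {subset slots a' m' <= slots a m} <->
  a * 2 ^+ m <= a' * 2 ^+ m' /\ (a' + 1) * 2 ^+ m' <= (a + 1) * 2 ^+ m.
Proof.
have e'_gt0 : 0 < 2 ^+ m' :> int by rewrite exprn_gt0.
split=> [sub|[la ha] z]; last by rewrite !mem_slots; lia.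
have := sub (a' * 2 ^+ m'); rewrite !mem_slots lexx mulrDl mul1r.
have := sub (a' * 2 ^+ m' + 2 ^+ m' - 1); rewrite !mem_slots mulrDl mul1r.
lia.
Qed.

(** The larger interval is a union of cells of the grid of mesh [2 ^+ m'], so it contains the whole
    cell of [z]. *)
Lemma slots_laminar a m a' m' z : z \in slots a m -> z \in slots a' m' ->
  (m' <= m)%N -> {subset slots a' m' <= slots a m}.
Proof.
rewrite !mem_slots => /andP[az za] /andP[az' za'] m'm; apply/slots_subset.
have e'_gt0 : 0 < 2 ^+ m' :> int by rewrite exprn_gt0.
move: az za; rewrite -(subnK m'm) exprD !mulrA => az za.
rewrite !ler_pM2r //.
have := le_lt_trans az za'; have := le_lt_trans az' za.
by rewrite !ltr_pM2r //; lia.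
Qed.

(** * Slots for the aligned windows *)

Theorem mainTheorem8 (R : realType) (k : int) (n : nat) (I J : instance R n)
    (I_under : underallocated (4 * 2 ^ k) I)
    (J_align : forall i : 'I_n, is_align (I i) (J i)) :
  underallocated (2 ^ k) J.
Proof.
have [S [lenS SI Sdisj]] := I_under.
have g_gt0 : 0 < 2 ^ k :> R by rewrite exprz_gt0.
have [a [m JE]] : exists (a : 'I_n -> int) (m : 'I_n -> nat), forall i,
    [/\ lo (J i) = (a i * 2 ^+ m i)%:~R * 2 ^ k,
        hi (J i) = ((a i + 1) * 2 ^+ m i)%:~R * 2 ^ k
      & len (J i) = (2 ^ m i)%:R * 2 ^ k].
  suff /choice[am amP] : forall i, exists am : int * nat,
      [/\ lo (J i) = (am.1 * 2 ^+ am.2)%:~R * 2 ^ k,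
          hi (J i) = ((am.1 + 1) * 2 ^+ am.2)%:~R * 2 ^ k
        & len (J i) = (2 ^ am.2)%:R * 2 ^ k].
    by exists (fst \o am), (snd \o am).
  move=> i; have [alignJ _ _] := J_align i.
  have [j [a [lJ hJ lenJ]]] := alignedP _ _ alignJ.
  (* Each window holds an interval of length [4 * 2 ^ k], so its aligned version has level at least
     [k], and [j - k] is a natural number. *)
  have kj : k <= j.
    rewrite -(@ler_eXz2l R 2) ?ltr1n // -lenJ.
    apply: (len_align_ge _ _ _ _ (J_align i)).
    have /subset_citv[] := SI i; have := lenS i; rewrite /len; lra.
  have ej : 2 ^ j = 2 ^+ `|(j - k)%R|%N * 2 ^ k :> R.
    rewrite (exprnP 2 `|(j - k)%R|%N) -expfzDr //; congr (_ ^ _); lia.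
  exists (a, `|(j - k)%R|%N) => /=.
  by rewrite lJ hJ lenJ ej !intrM rmorphXn natrX !mulrA.
have [f f_inj fJ] :
    exists2 f : 'I_n -> int, injective f & forall i, f i \in slots (a i) (m i).
  apply: laminar_system_of_representatives => [i|i i' z zi zi'|i A Ai].
  - exact: uniq_slots.
  - by rewrite !size_slots leq_exp2l //; apply: slots_laminar zi zi'.
  rewrite size_slots; have [alignJ _ _] := J_align i.
  have [x [y [yx xy hull]]] := align_hull _ _ alignJ.
  have [lJ hJ lenJ] := JE i.
  (* The hull has length [4 * len (J i)]; this factor 4 cancels the one in the length of the packed
     intervals. *)
  have := packing_bound _ _ (fun i' => lo (S i')) (4 * 2 ^ k) A x y xy.
  rewrite yx lenJ (mulrCA 4) ler_pM2r ?mulr_gt0 // ler_nat; apply=> //.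
    move=> i' /Ai/slots_subset[la ha].
    have [lJ' hJ' _] := JE i'.
    have [||xI Iy] := hull _ _ (J_align i').
    - by rewrite lJ lJ' ler_pM2r // ler_int.
    - by rewrite hJ hJ' ler_pM2r // ler_int.
    have /subset_citv[] := SI i'; have := lenS i'; rewrite /len; lra.
  move=> i1 i2 _ _ /Sdisj/interior_disjoint.
  by have := lenS i1; have := lenS i2; rewrite /len; lra.
exists (fun i => dyadic_citv k (f i)); split=> [i|i|i j ij].
- exact: len_dyadic.
- apply/subset_citv => /=; have [-> -> _] := JE i.
  by rewrite !ler_pM2r // !ler_int; have := fJ i; rewrite mem_slots; lia.
apply/interior_disjoint; rewrite /= !ler_pM2r // !ler_int.
have /eqP : f i != f j by apply: contra_neq ij; apply: f_inj.
lia.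
Qed.
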